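(* Let $K\ge 2$, let $\mathcal{X}_1,\dots,\mathcal{X}_K$ be Euclidean vector spaces, and let $X=(X_1,\dots,X_K)$ be a random vector with values in $\mathcal{X}=\mathcal{X}_1\times\cdots\times\mathcal{X}_K$ and distribution $\mathbb{P}_X$. Assume that for all $k\in\{1,\dots,K\}$ one has $\mathbb{E}(X_k)=0$, $\mathbb{E}(\Vert X_k\Vert_k^2)<+\infty$ and $V_k=I_k$ (the identity operator of $\mathcal{X}_k$). Then there exists $x_0\in\mathcal{X}$ such that $$\lim_{t\to+\infty}\Vert\mathrm{IF}(tx_0;T,\mathbb{P}_X)\Vert_{\mathcal{L}(\mathcal{X})}=+\infty,$$ where $\mathrm{IF}(x;T,\mathbb{P}_X)$ is the influence function of the functional $\mathbb{T}$ at $\mathbb{P}_X$ and $\Vert A\Vert_{\mathcal{L}(\mathcal{X})}=\sqrt{\mathrm{tr}(AA^* )}$.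
   Context: Euclidean vector spaces are (nonzero) finite-dimensional real inner product spaces; $\langle\cdot,\cdot\rangle_k$, $\Vert\cdot\Vert_k$ are the inner product and norm of $\mathcal{X}_k$, and $\mathcal{X}$ carries $\langle\alpha,\beta\rangle_{\mathcal{X}}=\sum_k\langle\alpha_k,\beta_k\rangle_k$. The tensor product $x\otimes y$ is the linear map $h\mapsto\langle x,h\rangle y$; $A^*$ is the adjoint of $A$. $\tau_k:\mathcal{X}\to\mathcal{X}_k$, $\alpha\mapsto\alpha_k$, is the canonical projection. $V_{k\ell}=\mathbb{E}(X_\ell\otimes X_k)$, $V_k=V_{kk}$. $\mathcal{L}(\mathcal{X})$ is the space of linear maps from $\mathcal{X}$ to itself, and $f,g:\mathcal{L}(\mathcal{X})\to\mathcal{L}(\mathcal{X})$ are $$f(A)=\sum_{k=1}^K\tau_k^*\tau_kA\tau_k^*\tau_k,\qquad g(A)=\sum_{k=1}^K\sum_{\ell\ne k}\tau_k^*\tau_kA\tau_\ell^*\tau_\ell .$$ For a probability measure $\mathbb{P}$ on $\mathcal{X}$ let $\mathbb{V}(\mathbb{P})=\int x\otimes x\,d\mathbb{P}(x)-\big(\int x\,d\mathbb{P}(x)\big)\otimes\big(\int x\,d\mathbb{P}(x)\big)$ and $\mathbb{T}(\mathbb{P})=f(\mathbb{V}(\mathbb{P}))^{-1/2}g(\mathbb{V}(\mathbb{P}))f(\mathbb{V}(\mathbb{P}))^{-1/2}$; $T=\mathbb{T}(\mathbb{P}_X)$. The influence function of a functional $S$ at $\mathbb{P}$ is $\mathrm{IF}(x;S,\mathbb{P})=\lim_{\varepsilon\downarrow0}\varepsilon^{-1}\big(S((1-\varepsilon)\mathbb{P}+\varepsilon\delta_x)-S(\mathbb{P})\big)$,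 with $\delta_x$ the Dirac measure at $x$; $\mathrm{IF}(x;T,\mathbb{P}_X)$ means $\mathrm{IF}(x;\mathbb{T},\mathbb{P}_X)$. *)

(* Defs.v *)
(* MathComp and MathComp-Analysis *)
From HB Require Import structures.
From mathcomp Require Import all_boot all_order all_algebra.
From mathcomp Require Import all_classical all_reals all_analysis.
From mathcomp Require Import sesquilinear.

Set Implicit Arguments.
Unset Strict Implicit.
Unset Printing Implicit Defensive.

Import Order.TTheory GRing.Theory Num.Theory.
Import VectorInternalTheory.
Import numFieldNormedType.Exports.
Local Open Scope classical_set_scope.
Local Open Scope ring_scope.

(* Finite-dimensional real inner product spaces. The null space is allowed
   here (the empty product is one): non-nullity has to be assumed separately. *)
HB.mixin Record Vector_isEuclidean (R : rcfType) E of Vector R E := {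
  edot : {dot E for @idfun R}
}.

#[short(type="euclideanType")]
HB.structure Definition Euclidean (R : rcfType) :=
  {E of Vector R E & Vector_isEuclidean R E}.

Section product.
Variables (R : rcfType) (n : nat).

Section vector_product.
Variable V_ : 'I_n -> vectType R.
Notation prodT := {dffun forall k, V_ k}.
Implicit Types x y z : prodT.

Definition dffun_zero : prodT := [ffun k => 0 : V_ k].
Definition dffun_opp x : prodT := [ffun k => - x k].
Definition dffun_add x y : prodT := [ffun k => x k + y k].
Definition dffun_scale (a : R) x : prodT := [ffun k => a *: x k].

Let addA : associative dffun_add.
Proof. by move=> x y z; apply/ffunP=> k; rewrite !ffunE addrA. Qed.
Let addC : commutative dffun_add.
Proof. by move=> x y; apply/ffunP=> k; rewrite !ffunE addrC. Qed.
Let add0 : left_id dffun_zero dffun_add.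
Proof. by move=> x; apply/ffunP=> k; rewrite !ffunE add0r. Qed.
Let addN : left_inverse dffun_zero dffun_opp dffun_add.
Proof. by move=> x; apply/ffunP=> k; rewrite !ffunE addNr. Qed.

HB.instance Definition _ := GRing.isZmodule.Build prodT addA addC add0 addN.

Let scaleA a b x : dffun_scale a (dffun_scale b x) = dffun_scale (a * b) x.
Proof. by apply/ffunP=> k; rewrite !ffunE scalerA. Qed.
Let scale1 : left_id 1 dffun_scale.
Proof. by move=> x; apply/ffunP=> k; rewrite !ffunE scale1r. Qed.
Let scaleDr : right_distributive dffun_scale +%R.
Proof. by move=> a x y; apply/ffunP=> k; rewrite !ffunE scalerDr. Qed.
Let scaleDl x : {morph dffun_scale^~ x : a b / a + b}.
Proof. by move=> a b; apply/ffunP=> k; rewrite !ffunE scalerDl. Qed.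

HB.instance Definition _ := GRing.Zmodule_isLmodule.Build R prodT
  scaleA scale1 scaleDr scaleDl.

Let vect_iso : Vector.axiom (\sum_k dim (V_ k))%N prodT.
Proof.
exists (fun x => \mxrow_k v2r (x k)).
  move=> a x y; apply/rowP => i.
  by rewrite !mxE !ffunE linearP !mxE.
exists (fun r => [ffun k => r2v (submxrow r k) : V_ k]) => [x|r].
  by apply/ffunP=> k; rewrite ffunE mxrowK v2rK.
by apply/mxrowP => k; rewrite mxrowK ffunE r2vK.
Qed.

HB.instance Definition _ := Lmodule_hasFinDim.Build R prodT vect_iso.

Definition tau_fun k (x : prodT) : V_ k := x k.

Let tau_linear k : linear (@tau_fun k).
Proof. by move=> a x y; rewrite /tau_fun !ffunE. Qed.

HB.instance Definition _ k := GRing.isLinear.Build R prodT (V_ k) _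
  (@tau_fun k) (@tau_linear k).

End vector_product.

Variable X_ : 'I_n -> euclideanType R.
Notation prodT := {dffun forall k, X_ k}.

Definition prod_dot (x y : prodT) : R := \sum_k edot (x k) (y k).

Let prod_dot_bilinear : bilinear_for *%R *%R prod_dot.
Proof.
split=> u a x y; rewrite /prod_dot/= [_ * _]mulr_sumr -big_split /=;
  apply: eq_bigr => k _; rewrite !ffunE.
  by rewrite linearPl.
by rewrite linearPr.
Qed.

HB.instance Definition _ := @bilinear_isBilinear.Build R prodT prodT R
  *%R (idfun \; *%R) prod_dot prod_dot_bilinear.

Let prod_dot_sym x y : prod_dot x y = (-1) ^+ false * idfun (prod_dot y x).
Proof.
rewrite expr0 mul1r; apply: eq_bigr => k _.
by rewrite [LHS]hermitian_subproof expr0 mul1r.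
Qed.

HB.instance Definition _ := @isHermitianSesquilinear.Build R prodT false idfun
  prod_dot prod_dot_sym.

Let prod_dot_gt0 x : x != 0 -> 0 < prod_dot x x.
Proof.
move=> x0; have [k xk] : exists k, x k != 0.
  apply/existsP; apply: contraNT x0; rewrite negb_exists => /forallP x0.
  by apply/eqP/ffunP => k; rewrite ffunE; apply/eqP; rewrite -[_ == _]negbK.
have ge0 j : 0 <= edot (x j) (x j).
  have [->|/neq0_dnorm_gt0/ltW//] := eqVneq (x j) 0.
  by rewrite linear0l.
rewrite /prod_dot (bigD1 k)//= ltr_wpDr ?sumr_ge0 ?neq0_dnorm_gt0//.
Qed.

HB.instance Definition _ := @isDotProduct.Build R prodT prod_dot prod_dot_gt0.

HB.instance Definition _ := Vector_isEuclidean.Build R prodT prod_dot.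

Definition tau k : 'Hom(prodT, X_ k) := linfun (@tau_fun X_ k).

End product.

Section euclidean_theory.
Variable R : rcfType.
Implicit Types E F : euclideanType R.

Definition enorm E (x : E) : R := Num.sqrt (edot x x).

Definition eopen E : set (set E) := [set U | forall x, U x ->
  exists2 r : R, 0 < r & forall y, enorm (y - x) < r -> U y].

Definition tensor E F (x : E) (y : F) : 'Hom(E, F) :=
  linfun (fun h => edot x h *: y).

(* By the Riesz representation theorem the set below is a singleton. *)
Definition adjoint E F (A : 'Hom(E, F)) : 'Hom(F, E) :=
  xget 0 [set B : 'Hom(F, E) | forall x y, edot (A x) y = edot x (B y)].

Definition self_adjoint E (A : 'End(E)) := adjoint A = A.

Definition positive E (A : 'End(E)) :=
  self_adjoint A /\ forall x, 0 <= edot (A x) x.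

(* The positive square root is unique, so nothing depends on the choice; the
   value is meaningless when A is not positive. *)
Definition lsqrt E (A : 'End(E)) : 'End(E) :=
  xget 0 [set B | positive B /\ (B \o B)%VF = A].

Definition inv_lsqrt E (A : 'End(E)) : 'End(E) := (lsqrt A)^-1%VF.

Definition ltrace E (A : 'End(E)) : R :=
  \tr (passmx.mxof (vbasis {:E}) (vbasis {:E}) A).

Definition hs_norm E (A : 'End(E)) : R :=
  Num.sqrt (ltrace (A \o adjoint A)%VF).

End euclidean_theory.

Definition pointed_euclidean (R : rcfType) (E : euclideanType R) : Type := E.
HB.instance Definition _ (R : rcfType) (E : euclideanType R) :=
  Choice.on (pointed_euclidean E).
HB.instance Definition _ (R : rcfType) (E : euclideanType R) :=
  isPointed.Build (pointed_euclidean E) (0 : E).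

(* E with its Borel sigma-algebra *)
Notation borel E :=
  (@g_sigma_algebraType (pointed_euclidean E) (@eopen _ E)).

(* In finite dimension, the integral of a vector-valued function is taken
   coordinatewise; it does not depend on the basis when f is integrable. *)
Definition vintegral d (T : measurableType d) (R : realType)
    (mu : {measure set T -> \bar R}) (F : vectType R) (f : T -> F) : F :=
  \sum_i (\int[mu]_w coord (vbasis {:F}) i (f w)) *: (vbasis {:F})`_i.

(* (1 - e) P + e \d_x, extended by P when e is not in [0, 1] *)
Section contamination.
Local Open Scope ereal_scope.
Context d (T : measurableType d) (R : realType).
Variables (P : probability T R) (x : T) (e : R).

Definition contamination (A : set T) : \bar R :=
  if (0 <= e <= 1)%R then (1 - e)%:E * P A + e%:E * \d_x A else P A.

Let contamination0 : contamination set0 = 0.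
Proof. by rewrite /contamination !measure0 !mule0 adde0 if_same. Qed.

Let contamination_ge0 A : 0 <= contamination A.
Proof.
rewrite /contamination; case: ifPn => // /andP[e0 e1].
by rewrite adde_ge0// mule_ge0// lee_fin// subr_ge0.
Qed.

Let contamination_sigma_additive : semi_sigma_additive contamination.
Proof.
move=> F mF tF mUF; rewrite /contamination; case: ifPn => [/andP[e0 e1]|_].
  have e10 : (0 <= 1 - e)%R by rewrite subr_ge0.
  have mE A : (1 - e)%:E * P A + e%:E * \d_x A =
      measure_add (mscale (NngNum e10) P) (mscale (NngNum e0) \d_x) A.
    by rewrite measure_addE.
  under eq_fun do under eq_bigr do rewrite mE.
  by rewrite mE; exact: measure_semi_sigma_additive.
exact: measure_semi_sigma_additive.
Qed.

HB.instance Definition _ := isMeasure.Build _ _ _ contamination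
  contamination0 contamination_ge0 contamination_sigma_additive.

Let contamination_setT : contamination setT = 1.
Proof.
rewrite /contamination !probability_setT !mule1 -EFinD subrK.
by rewrite if_same.
Qed.

HB.instance Definition _ :=
  @Measure_isProbability.Build _ _ R contamination contamination_setT.

End contamination.

Section influence.
Variables (R : realType) (E F : euclideanType R).
Variable S : probability (borel E) R -> 'End(F).

(* All norms on End(F) are equivalent, so convergence in End(F) is convergence
   for hs_norm. *)
Definition is_influence (P : probability (borel E) R) (x : E) (L : 'End(F)) :=
  hs_norm (e^-1 *: (S (contamination P x e) - S P) - L)
    @[e --> (0 : R)^'+] --> (0 : R).

(* Meaningful only when the limit exists. *)
Definition influence (P : probability (borel E) R) (x : E) : 'End(F) :=
  xget 0 [set L | is_influence P x L].

End influence.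

Section functional.
Variables (R : realType) (K : nat) (X_ : 'I_K -> euclideanType R).
Notation X := {dffun forall k, X_ k}.
Implicit Type A : 'End(X).

Definition diag_part A : 'End(X) :=
  \sum_k (adjoint (tau X_ k) \o tau X_ k \o A
    \o adjoint (tau X_ k) \o tau X_ k)%VF.

Definition offdiag_part A : 'End(X) :=
  \sum_k \sum_(l | l != k) (adjoint (tau X_ k) \o tau X_ k \o A
    \o adjoint (tau X_ l) \o tau X_ l)%VF.

Definition cov_op (P : probability (borel X) R) : 'End(X) :=
  let m : X := vintegral P (fun x : borel X => x : X) in
  vintegral P (fun x : borel X => tensor (x : X) (x : X)) - tensor m m.

Definition T_functional (P : probability (borel X) R) : 'End(X) :=
  let fV := inv_lsqrt (diag_part (cov_op P)) in (fV \o offdiag_part (cov_op P) \o fV)%VF.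

End functional.

(* Main.v *)
(* Write p_k for the component of x in X_k, seen in the product, and x (x) x for
   the rank one operator h |-> <x, h> x. The contaminated measure has covariance
   (1 - e) (V + e x (x) x), whose diagonal part is (1 - e) (1 + e D) with
   D = sum_k p_k (x) p_k because V_k = 1. The vectors p_k being orthogonal, the
   inverse square root of 1 + e D is an explicit combination of 1 and the
   p_k (x) p_k, so that with B and G the off-diagonal parts of V and x (x) x the
   influence function is G - (D B + B D) / 2. It is quadratic in x, so its norm
   at t x tends to infinity as soon as it is nonzero at x. It cannot vanish
   everywhere: changing the sign of one component of x preserves D and changes
   the sign of some nonzero blocks of G. *)
Require Import Defs.
From HB Require Import structures.
From mathcomp Require Import all_boot all_order all_algebra.
From mathcomp Require Import all_classical all_reals all_analysis.
From mathcomp Require Import sesquilinear measurable_realfun ring lra.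

Set Implicit Arguments.
Unset Strict Implicit.
Unset Printing Implicit Defensive.

Import Order.TTheory GRing.Theory Num.Theory.
Import passmx.
Import numFieldNormedType.Exports.
Local Open Scope classical_set_scope.
Local Open Scope ring_scope.

(** * Euclidean spaces *)

Section inner_product.
Variable R : rcfType.
Implicit Types E F : euclideanType R.

Lemma edotC E (x y : E) : edot x y = edot y x.
Proof. by rewrite [LHS]hermitian_subproof expr0 mul1r. Qed.

Lemma edotZr E a (x y : E) : edot x (a *: y) = a * edot x y.
Proof. by rewrite linearZr_LR. Qed.

Lemma edotZl E a (x y : E) : edot (a *: x) y = a * edot x y.
Proof. by rewrite edotC edotZr edotC. Qed.

Lemma edot0r E (x : E) : edot x 0 = 0.
Proof. by rewrite -(scale0r 0) edotZr mul0r. Qed.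

Lemma edot0l E (x : E) : edot 0 x = 0.
Proof. by rewrite edotC edot0r. Qed.

Lemma edotDr E (x y z : E) : edot x (y + z) = edot x y + edot x z.
Proof. by rewrite linearDr. Qed.

Lemma edotDl E (x y z : E) : edot (y + z) x = edot y x + edot z x.
Proof. by rewrite !(edotC _ x) edotDr. Qed.

Lemma edotNr E (x y : E) : edot x (- y) = - edot x y.
Proof. by rewrite -scaleN1r edotZr mulN1r. Qed.

Lemma edotNl E (x y : E) : edot (- y) x = - edot y x.
Proof. by rewrite !(edotC _ x) edotNr. Qed.

Lemma edotBr E (x y z : E) : edot x (y - z) = edot x y - edot x z.
Proof. by rewrite edotDr edotNr. Qed.

Lemma edotBl E (x y z : E) : edot (y - z) x = edot y x - edot z x.
Proof. by rewrite edotDl edotNl. Qed.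

Lemma edot_sumr E I (r : seq I) (p : pred I) (f : I -> E) x :
  edot x (\sum_(i <- r | p i) f i) = \sum_(i <- r | p i) edot x (f i).
Proof.
apply: (big_morph (edot x) (id1 := 0) (op1 := +%R)); last exact: edot0r.
exact: edotDr.
Qed.

Lemma edot_suml E I (r : seq I) (p : pred I) (f : I -> E) x :
  edot (\sum_(i <- r | p i) f i) x = \sum_(i <- r | p i) edot (f i) x.
Proof. by rewrite edotC edot_sumr; apply: eq_bigr => i _; exact: edotC. Qed.

Lemma edot_gt0 E (x : E) : x != 0 -> 0 < edot x x.
Proof. exact: neq0_dnorm_gt0. Qed.

Lemma edot_ge0 E (x : E) : 0 <= edot x x.
Proof. by have [->|/edot_gt0/ltW//] := eqVneq x 0; rewrite edot0l. Qed.

Lemma edot_eq0 E (x : E) : edot x x = 0 -> x = 0.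
Proof.
by move=> x0; apply/eqP; apply: contraT => /edot_gt0; rewrite x0 ltxx.
Qed.

Lemma edot_inj E (x y : E) : (forall z, edot z x = edot z y) -> x = y.
Proof.
move=> xy; apply/eqP; rewrite -subr_eq0; apply/eqP/edot_eq0.
by rewrite edotBr xy subrr.
Qed.

Lemma lfun_edotP E F (A B : 'Hom(E, F)) :
  (forall y x, edot y (A x) = edot y (B x)) -> A = B.
Proof. by move=> AB; apply/lfunP => x; apply: edot_inj => y. Qed.

(** The squared norm of [<y, y> x - <x, y> y] is [<y, y>] times the right-hand side minus the
    left-hand side. *)
Lemma edot_CauchySchwarz E (x y : E) :
  (edot x y) ^+ 2 <= edot x x * edot y y.
Proof.
have [->|y0] := eqVneq y 0; first by rewrite !edot0r expr0n mulr0.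
have yy : 0 < edot y y by exact: edot_gt0.
have := edot_ge0 (edot y y *: x - edot x y *: y).
rewrite !(edotBl, edotBr) !(edotZl, edotZr) (edotC y x) => h.
rewrite -subr_ge0 -(pmulr_rge0 _ yy); apply: le_trans h _.
by rewrite le_eqVlt; apply/orP; left; apply/eqP; ring.
Qed.

(** From [2 |a b| <= a^2 + b^2] and Cauchy-Schwarz; the bound later dominates products of two linear
    forms of a square integrable vector. *)
Lemma norm_edotM_le E (u v x : E) :
  `|edot u x * edot v x| <= (edot u u + edot v v) * edot x x.
Proof.
have := mulr_ge0 (edot_ge0 u) (edot_ge0 x).
have := mulr_ge0 (edot_ge0 v) (edot_ge0 x).
have := edot_CauchySchwarz u x; have := edot_CauchySchwarz v x.
rewrite ler_norml mulrDl; move: (edot u x) (edot v x) => a b.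
have := sqr_ge0 (a + b); have := sqr_ge0 (a - b); rewrite sqrrB sqrrD => *.
by apply/andP; split; lra.
Qed.

Lemma enorm_sqr E (x : E) : enorm x ^+ 2 = edot x x.
Proof. by rewrite sqr_sqrtr// edot_ge0. Qed.

Lemma tensorE E F (x : E) (y : F) h : tensor x y h = edot x h *: y.
Proof.
have lin : linear (fun h => edot x h *: y).
  by move=> a u v; rewrite edotDr edotZr scalerDl scalerA.
pose f : {linear E -> F} :=
  HB.pack (fun h => edot x h *: y) (GRing.isLinear.Build _ _ _ _ _ lin).
exact: (lfunE f h).
Qed.

Lemma tensorZ E a (x : E) :
  tensor (a *: x) (a *: x) = a ^+ 2 *: tensor x x.
Proof.
apply/lfunP => y; rewrite lfunE/= !tensorE edotZl !scalerA; congr (_ *: _).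
by ring.
Qed.

Definition orthonormal_family E n (e : 'I_n -> E) :=
  (forall i j, edot (e i) (e j) = (i == j)%:R) /\
  (forall x, x = \sum_i edot (e i) x *: e i).

(** Gram-Schmidt by contradiction: if no orthonormal family expands every vector, each one can be
    lengthened, although such families are free and hence no longer than the dimension. *)
Lemma exists_orthonormal_family E : exists n (e : 'I_n -> E),
  orthonormal_family e.
Proof.
apply: contrapT => noE.
have free_on n (e : 'I_n -> E) :
    (forall i j, edot (e i) (e j) = (i == j)%:R) -> (n <= \dim {:E})%N.
  move=> eon; have : free [tuple e i | i < n].
    apply/freeP => a a0 i; have := congr1 (edot (e i)) a0.
    rewrite edot0r edot_sumr (bigD1 i)//= big1 ?addr0 => [|j ji].
      by rewrite edotZr nth_mktuple eon eqxx mulr1.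
    by rewrite edotZr nth_mktuple eon eq_sym (negPf ji) mulr0.
  by rewrite /free size_tuple => /eqP {1}<-; rewrite dimvS// subvf.
suff /(_ (\dim {:E}).+1) [e /free_on] : forall n, exists e : 'I_n -> E,
    forall i j, edot (e i) (e j) = (i == j)%:R by rewrite ltnn.
elim=> [|n [e eon]]; first by exists (fun=> 0) => -[].
have [x xe] : exists x, x != \sum_i edot (e i) x *: e i.
  apply: contrapT => nox; apply: noE; exists n, e; split=> // x.
  by apply/eqP; apply: contrapT => /negP xe; apply: nox; exists x.
pose y := x - \sum_i edot (e i) x *: e i.
have y0 : 0 < edot y y by rewrite edot_gt0// subr_eq0.
have ey i : edot (e i) y = 0.
  rewrite edotBr edot_sumr (bigD1 i)//= big1 ?addr0 => [|j ji].
    by rewrite edotZr eon eqxx mulr1 subrr.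
  by rewrite edotZr eon eq_sym (negPf ji) mulr0.
pose v := (Num.sqrt (edot y y))^-1 *: y.
have vv : edot v v = 1.
  rewrite edotZl edotZr mulrA -invfM -expr2 sqr_sqrtr ?ltW//.
  by rewrite mulVf// gt_eqF.
have ev i : edot (e i) v = 0 by rewrite edotZr ey mulr0.
exists (fun i => oapp e v (unlift ord_max i)) => i j.
case: (unliftP ord_max i) => [i'|] ->; case: (unliftP ord_max j) => [j'|] -> /=.
- by rewrite eon (inj_eq lift_inj).
- by rewrite ev eq_sym (negPf (neq_lift _ _)).
- by rewrite edotC ev (negPf (neq_lift _ _)).
- by rewrite vv eqxx.
Qed.

(** The choice made in [adjoint] is not the default value: the map sending [y] to the sum of the
    [<A e_i, y> e_i] is an adjoint. *)
Lemma adjointE E F (A : 'Hom(E, F)) x y :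
  edot (A x) y = edot x (adjoint A y).
Proof.
have [n [e [_ eE]]] := exists_orthonormal_family E.
rewrite /adjoint; case: xgetP => [B _ AB|noB]; first exact: AB.
case: (noB (\sum_i tensor (A (e i)) (e i))) => {}x {}y /=.
rewrite sum_lfunE edot_sumr {1}(eE x) linear_sum/= edot_suml.
by apply: eq_bigr => i _; rewrite linearZ/= edotZl tensorE edotZr mulrC (edotC
  x).
Qed.

Lemma adjointP E F (A : 'Hom(E, F)) (B : 'Hom(F, E)) :
  (forall x y, edot (A x) y = edot x (B y)) -> adjoint A = B.
Proof. by move=> AB; apply: lfun_edotP => x y; rewrite -adjointE AB. Qed.

Lemma self_adjointP E (A : 'End(E)) :
  self_adjoint A <-> forall x y, edot (A x) y = edot x (A y).
Proof. by split=> [AA x y|/adjointP//]; rewrite adjointE AA. Qed.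

Lemma ltraceC E (A B : 'End(E)) : ltrace (A \o B)%VF = ltrace (B \o A)%VF.
Proof.
pose b := vbasis {:E}.
have mxofM (C D : 'End(E)) :
    passmx.mxof b b (C \o D)%VF = passmx.mxof b b D *m passmx.mxof b b C.
  by apply: passmx.mxof_comp; exact: vbasisP.
by rewrite /ltrace !mxofM mxtrace_mulC.
Qed.

Lemma ltrace_tensor E (x y : E) : ltrace (tensor x y) = edot x y.
Proof.
rewrite /ltrace /mxtrace; under eq_bigr do rewrite !mxE/= tensorE
  passmx.vecof_delta linearZ/=.
rewrite {2}(coord_vbasis (memvf y)) edot_sumr.
by apply: eq_bigr => i _; rewrite edotZr mulrC.
Qed.

(** [A] is the sum of the rank one maps [tensor (e i) (A (e i))], whose traces are known. This frees
    the trace from [vbasis], which need not be orthonormal. *)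
Lemma ltraceE E n (e : 'I_n -> E) (A : 'End(E)) : orthonormal_family e ->
  ltrace A = \sum_i edot (e i) (A (e i)).
Proof.
case=> _ eE; rewrite -[in LHS](_ : \sum_i tensor (e i) (A (e i)) = A);
  last first.
  apply/lfunP => x; rewrite sum_lfunE/= [in RHS](eE x) linear_sum.
  by apply: eq_bigr => i _; rewrite tensorE linearZ.
rewrite /ltrace linear_sum/= linear_sum/=.
by apply: eq_bigr => i _; rewrite -ltrace_tensor.
Qed.

Lemma hs_normE E n (e : 'I_n -> E) (A : 'End(E)) : orthonormal_family e ->
  hs_norm A = Num.sqrt (\sum_i edot (A (e i)) (A (e i))).
Proof.
move=> eon; rewrite /hs_norm ltraceC (ltraceE _ eon); congr Num.sqrt.
by apply: eq_bigr => i _; rewrite comp_lfunE -adjointE.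
Qed.

Lemma hs_norm_ge0 E (A : 'End(E)) : 0 <= hs_norm A.
Proof. exact: sqrtr_ge0. Qed.

Lemma hs_norm_eq0 E (A : 'End(E)) : hs_norm A = 0 -> A = 0.
Proof.
have [n [e eon]] := exists_orthonormal_family E.
have s0 : 0 <= \sum_i edot (A (e i)) (A (e i)) by rewrite sumr_ge0// => i _;
  exact: edot_ge0.
rewrite (hs_normE _ eon) => /eqP; rewrite sqrtr_eq0 => sle0.
have /eqP : \sum_i edot (A (e i)) (A (e i)) = 0 by apply/eqP;
  rewrite eq_le s0 sle0.
rewrite psumr_eq0 => [/allP Ae|i _]; last exact: edot_ge0.
apply/lfunP => x; rewrite (eon.2 x) !linear_sum/= big1 ?big1// => i _.
  by rewrite zero_lfunE.
by rewrite linearZ/= (edot_eq0 (eqP (Ae i _))) ?mem_index_enum// scaler0.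
Qed.

Lemma hs_normZ E a (A : 'End(E)) : hs_norm (a *: A) = `|a| * hs_norm A.
Proof.
have [n [e eon]] := exists_orthonormal_family E.
rewrite !(hs_normE _ eon) -sqrtr_sqr -sqrtrM ?sqr_ge0// mulr_sumr.
by congr Num.sqrt; apply: eq_bigr => i _;
  rewrite scale_lfunE edotZl edotZr mulrA.
Qed.

(** A substitute for the triangle inequality, obtained from [0 <= |u + v|^2] on each basis vector;
    it suffices for the uniqueness of limits. *)
Lemma hs_norm_sqrB E (A B : 'End(E)) :
  hs_norm (A - B) ^+ 2 <= 2 * hs_norm A ^+ 2 + 2 * hs_norm B ^+ 2.
Proof.
have [n [e eon]] := exists_orthonormal_family E.
rewrite !(hs_normE _ eon) !sqr_sqrtr ?sumr_ge0//;
  do ?[by move=> i _; exact: edot_ge0].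
rewrite !mulr_sumr -big_split/=; apply: ler_sum => i _.
rewrite !lfunE/= !lfunE/=; move: (A _) (B _) => u v.
have := edot_ge0 (u + v); rewrite !(edotDl, edotDr) (edotC v u) => ?.
by rewrite !(edotDl, edotDr, edotNl, edotNr) (edotC v u); lra.
Qed.

(* With [S = B - C], [B \o S = - (S \o C)]; hence [tr (S B S) = - tr (S C S)],
   where both traces are nonnegative, so that [S B S] has trace zero. *)
Lemma positive_sqrt_unique E (B C : 'End(E)) :
  self_adjoint B -> (forall x, x != 0 -> 0 < edot (B x) x) -> positive C ->
  (B \o B = C \o C)%VF -> B = C.
Proof.
move=> /self_adjointP sB Bgt0 [/self_adjointP sC Cge0] BBCC.
have [n [e eon]] := exists_orthonormal_family E.
pose S := B - C; have SE x : S x = B x - C x by rewrite !lfunE/= !lfunE.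
have sS x y : edot (S x) y = edot x (S y).
  by rewrite !SE edotBl edotBr sB sC.
have Bge0 x : 0 <= edot (B x) x.
  by have [->|/Bgt0/ltW//] := eqVneq x 0; rewrite edot0r.
have BS : (B \o S)%VF = - (S \o C)%VF.
  apply/lfunP => x; rewrite opp_lfunE !comp_lfunE !SE linearB/= opprB.
  by congr (_ - _); rewrite -!comp_lfunE BBCC.
have trS A : ltrace (S \o (A \o S))%VF = \sum_i edot (A (S (e i))) (S (e i)).
  rewrite (ltraceE _ eon); apply: eq_bigr => i _.
  by rewrite !comp_lfunE -sS edotC.
have : ltrace (S \o (B \o S))%VF = - ltrace (S \o (C \o S))%VF.
  rewrite BS comp_lfunNr [in RHS]comp_lfunA (ltraceC (S \o C)%VF).
  by rewrite /ltrace !linearN.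
rewrite !trS => h.
have /eqP : \sum_i edot (B (S (e i))) (S (e i)) = 0.
  apply/eqP; rewrite eq_le; apply/andP; split; last by rewrite sumr_ge0.
  by rewrite h oppr_le0 sumr_ge0.
(* Each term of this zero sum of nonnegative terms vanishes, and strict positivity of [B] forces
   [S (e i) = 0]. *)
rewrite psumr_eq0// => /allP Se.
apply/eqP; rewrite -subr_eq0 -/S; apply/eqP/lfunP => x.
rewrite (eon.2 x) !linear_sum/=; apply: eq_bigr => i _.
rewrite !linearZ/= zero_lfunE; congr (_ *: _).
apply/eqP; apply: contraT => /Bgt0.
by rewrite (eqP (Se i _)) ?mem_index_enum// ltxx.
Qed.

(** Uniqueness of the positive square root forces the choice in [lsqrt]; since a strictly positive
    [B] is injective, its right inverse [C] is its inverse. *)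
Lemma inv_lsqrt_eq E (B C : 'End(E)) :
  self_adjoint B -> (forall x, x != 0 -> 0 < edot (B x) x) ->
  (B \o C = \1)%VF -> inv_lsqrt (B \o B)%VF = C.
Proof.
move=> sB Bgt0 BC1.
have pB : positive B.
  split=> // x; have [->|/Bgt0/ltW//] := eqVneq x 0; by rewrite edot0r.
rewrite /inv_lsqrt (_ : lsqrt _ = B); last first.
  rewrite /lsqrt; case: xgetP => [D _ [pD DD]|/(_ B)[]//].
  by apply/esym/positive_sqrt_unique.
have kB : lker B == 0%VS.
  apply/lker0P => x y Bxy; apply/eqP; rewrite -subr_eq0; apply: contraT.
  move=> /Bgt0; rewrite (_ : B (x - y) = 0) ?edot0l ?ltxx//.
  by rewrite linearB/= Bxy subrr.
by rewrite -[LHS]comp_lfun1r -BC1 comp_lfunA lker0_compVf// comp_lfun1l.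
Qed.

End inner_product.
(** * Convergence of operators *)

Section weak_convergence.
Variables (R : realType) (T : Type) (F : set_system T).
Hypothesis FF : ProperFilter F.

Lemma cvg_sumr n (f : 'I_n -> T -> R) (l : 'I_n -> R) :
  (forall i, f i t @[t --> F] --> l i) ->
  (\sum_i f i t) @[t --> F] --> \sum_i l i.
Proof. by move=> fl; apply: cvg_big => // -[x y]; exact: add_continuous. Qed.

Lemma cvg_sumr0 n (f : 'I_n -> T -> R) :
  (forall i, f i t @[t --> F] --> (0 : R)) ->
  (\sum_i f i t) @[t --> F] --> (0 : R).
Proof. by move=> /cvg_sumr; rewrite big1_eq. Qed.

(** Convergence entry by entry. In finite dimension it amounts to convergence for [hs_norm], and it
    reduces sums and compositions to limits of real functions. *)
Definition weakly_cvg (E : euclideanType R) (A : T -> 'End(E)) (L : 'End(E)) :=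
  forall y x, edot y (A t x) @[t --> F] --> edot y (L x).

Variable E : euclideanType R.
Implicit Types (A B : T -> 'End(E)) (L M : 'End(E)).

Lemma weakly_cvg_cst L : weakly_cvg (fun=> L) L.
Proof. by move=> y x; exact: cvg_cst. Qed.

Lemma weakly_cvgD A B L M : weakly_cvg A L -> weakly_cvg B M ->
  weakly_cvg (fun t => A t + B t) (L + M).
Proof.
move=> AL BM y x; rewrite lfunE/= edotDr.
under eq_fun do rewrite lfunE/= edotDr.
exact: cvgD.
Qed.

Lemma weakly_cvgZ (a : T -> R) (b : R) A L :
  a t @[t --> F] --> b -> weakly_cvg A L ->
  weakly_cvg (fun t => a t *: A t) (b *: L).
Proof.
move=> ab AL y x; rewrite lfunE/= edotZr.
under eq_fun do rewrite lfunE/= edotZr.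
exact: cvgM.
Qed.

Lemma weakly_cvg_sum n (A : 'I_n -> T -> 'End(E)) (L : 'I_n -> 'End(E)) :
  (forall i, weakly_cvg (A i) (L i)) ->
  weakly_cvg (fun t => \sum_i A i t) (\sum_i L i).
Proof.
move=> AL y x; rewrite sum_lfunE edot_sumr.
under eq_fun do rewrite sum_lfunE edot_sumr.
by apply: cvg_sumr => i; exact: AL.
Qed.

(** An orthonormal family turns an entry of the composite into a finite sum of products of entries,
    as for matrices. *)
Lemma weakly_cvg_comp A B L M : weakly_cvg A L -> weakly_cvg B M ->
  weakly_cvg (fun t => A t \o B t)%VF (L \o M)%VF.
Proof.
have [n [e [_ eE]]] := exists_orthonormal_family E.
have compE (C D : 'End(E)) y x : edot y ((C \o D)%VF x) =
    \sum_i edot (e i) (D x) * edot y (C (e i)).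
  rewrite comp_lfunE [D x in LHS]eE linear_sum edot_sumr.
  by apply: eq_bigr => i _; rewrite linearZ/= edotZr.
move=> AL BM y x; rewrite compE.
under eq_fun do rewrite compE.
by apply: cvg_sumr => i; apply: cvgM; [exact: BM|exact: AL].
Qed.

(** [hs_norm] is the root of a finite sum of squared entries, each of which tends to zero. *)
Lemma weakly_cvg_hs_norm A L : weakly_cvg A L ->
  hs_norm (A t - L) @[t --> F] --> (0 : R).
Proof.
have [n [e eon]] := exists_orthonormal_family E.
move=> AL; rewrite -(sqrtr0 R).
under eq_fun do rewrite (hs_normE _ eon).
apply: continuous_cvg; first exact: sqrt_continuous.
apply: cvg_sumr0 => i.
have AL0 : weakly_cvg (fun t => A t - L) 0.
  by rewrite -[0](subrr L); apply: weakly_cvgD => //; exact: weakly_cvg_cst.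
have -> : (fun t => edot ((A t - L) (e i)) ((A t - L) (e i))) =
    (fun t => \sum_j (edot (e j) ((A t - L) (e i))) ^+ 2).
  apply/funext => t; rewrite [X in edot X _](eon.2) edot_suml.
  by apply: eq_bigr => j _; rewrite edotZl expr2.
apply: cvg_sumr0 => j; rewrite -[X in _ --> X](mulr0 0).
have := AL0 (e j) (e i); rewrite zero_lfunE edot0r => h.
by apply: cvgM.
Qed.

Lemma hs_norm_cvg_unique A L M :
  hs_norm (A t - L) @[t --> F] --> (0 : R) ->
  hs_norm (A t - M) @[t --> F] --> (0 : R) -> L = M.
Proof.
move=> AL AM; apply/eqP; rewrite eq_sym -subr_eq0; apply/eqP/hs_norm_eq0/eqP.
rewrite -sqrf_eq0 eq_le sqr_ge0 andbT.
have h : 2 * hs_norm (A t - L) ^+ 2 + 2 * hs_norm (A t - M) ^+ 2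
    @[t --> F] --> (2 * (0 * 0) + 2 * (0 * 0) : R).
  by apply: cvgD; apply: cvgM; try exact: cvg_cst; exact: cvgM.
rewrite !mulr0 addr0 in h.
rewrite -(cvg_lim _ h)//; apply: limr_ge; first exact: cvgP h.
apply: nearW => t; apply: le_trans (hs_norm_sqrB _ _).
by rewrite (_ : A t - L - (A t - M) = M - L)// opprB addrC addrA subrK.
Qed.

End weak_convergence.
(** * Moments *)

Section moments.
Variable R : realType.

Lemma riesz (E : euclideanType R) (f : {scalar E}) :
  exists u, forall x, f x = edot u x.
Proof.
have [n [e [_ eE]]] := exists_orthonormal_family E.
exists (\sum_i f (e i) *: e i) => x.
rewrite {1}(eE x) linear_sum/= edot_suml; apply: eq_bigr => i _.
by rewrite linearZ/= edotZl mulrC.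
Qed.

Lemma measurable_edot (E : euclideanType R) (u : E) :
  measurable_fun [set: borel E] (fun x : borel E => edot u (x : E)).
Proof.
move=> _; apply: (measurability _ (RGenOInfty.measurableE R)) => //.
move=> _ [_ [a ->] <-]; rewrite setTI; apply: sub_sigma_algebra => x /=.
rewrite in_itv/= andbT => ax.
have N0 : 0 <= enorm u by exact: sqrtr_ge0.
have N1 : 0 < enorm u + 1 by rewrite ltr_wpDl.
(* By Cauchy-Schwarz, [edot u] varies by less than [edot u x - a] on this ball, so the half-space is
   open; the [+ 1] takes care of [u = 0]. *)
exists ((edot u (x : E) - a) / (enorm u + 1)).
  by rewrite divr_gt0// subr_gt0.
move=> y; rewrite ltr_pdivlMr// => yx; rewrite in_itv/= andbT.
have := edot_CauchySchwarz u (y - (x : E)); rewrite -!enorm_sqr -exprMn.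
rewrite -[X in X <= _]real_normK ?num_real// ler_pXn2r ?nnegrE ?mulr_ge0
  ?sqrtr_ge0//.
rewrite edotBr ler_norml => /andP[+ _].
by have : 0 <= enorm (y - (x : E)) := sqrtr_ge0 _; move: yx N0; nra.
Qed.

Section moments_of.
Context d (T : measurableType d) (mu : {measure set T -> \bar R}).
Local Notation integrableR f := (mu.-integrable setT (EFin \o f)).

Lemma integrableR_sum n (f : 'I_n -> T -> R) : (forall i, integrableR (f i)) ->
  integrableR (fun t => \sum_i f i t).
Proof.
move=> fi.
apply: eq_integrable (integrable_sum measurableT (index_enum 'I_n) (fun i _ =>
  fi i)) => //= t _.
by rewrite sumEFin.
Qed.

Lemma integrableRZ a (f : T -> R) : integrableR f ->
  integrableR (fun t => a * f t).
Proof.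
by move=> /(integrableZl measurableT a); apply: eq_integrable => // t _.
Qed.

Lemma Rintegral_sum n (f : 'I_n -> T -> R) : (forall i, integrableR (f i)) ->
  \int[mu]_t (\sum_i f i t) = \sum_i \int[mu]_t f i t.
Proof.
elim: n f => [|n IH] f fi.
  by rewrite big_ord0; under eq_Rintegral do rewrite big_ord0;
    rewrite /Rintegral integral0.
rewrite big_ord_recr/= -IH//; under eq_Rintegral do rewrite big_ord_recr/=.
by rewrite RintegralD//; exact: integrableR_sum.
Qed.

(** A linear form is a combination of the coordinates, so the coordinatewise integral is also the
    weak one; the basis disappears from later arguments. *)
Lemma linear_vintegral (F : vectType R) (f : T -> F) (phi : {scalar F}) :
  (forall psi : {scalar F}, integrableR (psi \o f)) ->
  phi (vintegral mu f) = \int[mu]_t phi (f t).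
Proof.
move=> fi; rewrite /vintegral linear_sum/=.
have ci i : integrableR (fun t => coord (vbasis {:F}) i (f t)).
  exact: (fi (coord (vbasis {:F}) i)).
under [RHS]eq_Rintegral do rewrite (coord_vbasis (memvf (f _))) linear_sum/=.
under [RHS]eq_Rintegral do under eq_bigr do rewrite linearZ/= mulrC.
rewrite Rintegral_sum => [|i]; last exact: integrableRZ.
by apply: eq_bigr => i _; rewrite linearZ/= RintegralZl// mulrC.
Qed.

Variables (E : euclideanType R) (X : T -> E).
Hypothesis X1 : forall u, integrableR (fun t => edot u (X t)).
Hypothesis X2 : forall u v, integrableR (fun t => edot u (X t) * edot v (X t)).

Lemma edot_vintegral u : edot u (vintegral mu X) = \int[mu]_t edot u (X t).
Proof.
apply: (linear_vintegral (edot u)) => psi; have [v psiE] := riesz psi.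
by rewrite (_ : _ \o _ = fun t => edot v (X t))//; apply/funext => t /=.
Qed.

Lemma edot_vintegral_tensor u v :
  edot u (vintegral mu (fun t => tensor (X t) (X t)) v) =
  \int[mu]_t (edot v (X t) * edot u (X t)).
Proof.
have lin : scalar (fun A : 'End(E) => edot u (A v)).
  by move=> a A B; rewrite !lfunE/= lfunE/= edotDr edotZr.
pose phi : {scalar 'End(E)} :=
  HB.pack (fun A : 'End(E) => edot u (A v)) (GRing.isLinear.Build _ _ _ _ _
    lin).
have [n [e [_ eE]]] := exists_orthonormal_family E.
rewrite -[LHS]/(phi _) linear_vintegral => [|psi].
  by apply: eq_Rintegral => t _; rewrite /phi/= tensorE edotZr (edotC v).
(* Expanding both factors in an orthonormal family, any linear form of the tensor is a finite
   combination of the products that [X2] makes integrable. *)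
have -> : psi \o (fun t => tensor (X t) (X t)) = fun t => \sum_i \sum_j
    psi (tensor (e i) (e j)) * (edot (e i) (X t) * edot (e j) (X t)).
  apply/funext => t /=.
  have -> : tensor (X t) (X t) = \sum_i \sum_j
      (edot (e i) (X t) * edot (e j) (X t)) *: tensor (e i) (e j).
    apply/lfunP => x; rewrite tensorE sum_lfunE {1}(eE (X t)) edot_suml
      scaler_suml.
    apply: eq_bigr => i _; rewrite sum_lfunE {2}(eE (X t)) scaler_sumr.
    apply: eq_bigr => j _.
    by rewrite lfunE/= tensorE edotZl !scalerA mulrAC.
  rewrite linear_sum/=; apply: eq_bigr => i _; rewrite linear_sum/=.
  by apply: eq_bigr => j _; rewrite linearZ/= mulrC.
apply: integrableR_sum => i; apply: integrableR_sum => j.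
exact: integrableRZ.
Qed.

End moments_of.

(** * Integration against a contaminated measure *)

Section contamination_integral.
Context d (T : measurableType d) (P : probability T R) (x : T) (e : R).
Hypotheses (e0 : 0 <= e) (e1 : e <= 1).

Lemma ge0_integral_contamination (f : T -> \bar R) :
  measurable_fun [set: T] f -> (forall t, 0 <= f t)%E ->
  (\int[contamination P x e]_t f t =
   (1 - e)%:E * \int[P]_t f t + e%:E * f x)%E.
Proof.
move=> mf f0; have e10 : 0 <= 1 - e by rewrite subr_ge0.
rewrite (eq_measure_integral
  (measure_add (mscale (NngNum e10) P) (mscale (NngNum e0) \d_x))) => [|A mA _].
  rewrite ge0_integral_measure_add// !ge0_integral_mscale//=.
  by rewrite integral_dirac// diracT mul1e.
rewrite [LHS]/= /contamination e0 e1; apply/esym; exact: measure_addE.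
Qed.

Lemma integrable_contamination (f : T -> R) : P.-integrable setT (EFin \o f) ->
  (contamination P x e).-integrable setT (EFin \o f).
Proof.
move=> /integrableP[mf fi]; apply/integrableP; split => //.
rewrite ge0_integral_contamination//; last exact: measurableT_comp.
by rewrite lte_add_pinfty// ?lte_mul_pinfty// ?lee_fin ?subr_ge0// ltry.
Qed.

(** The nonnegative case is applied to the positive and negative parts, whose integrals are
    finite. *)
Lemma Rintegral_contamination (f : T -> R) : P.-integrable setT (EFin \o f) ->
  \int[contamination P x e]_t f t = (1 - e) * \int[P]_t f t + e * f x.
Proof.
move=> fi; have mf : measurable_fun [set: T] (EFin \o f)
  by case/integrableP: fi.
have fip := integrable_fin_num measurableT (integrable_funepos measurableT fi).
have fin := integrable_fin_num measurableT (integrable_funeneg measurableT fi).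
rewrite /Rintegral integralE [in RHS]integralE.
rewrite !ge0_integral_contamination//; try exact: measurable_funepos;
  try exact: measurable_funeneg.
have -> : (EFin \o f)^\+%E x = (Num.max (f x) 0)%:E
  by rewrite funeposE EFin_max.
have -> : (EFin \o f)^\-%E x = (Num.max (- f x) 0)%:E
  by rewrite funenegE EFin_max.
have fx : f x = Num.max (f x) 0 - Num.max (- f x) 0.
  have [f0|f0] := leP 0 (f x).
    by rewrite max_r ?subr0// oppr_le0.
  by rewrite max_l ?oppr_ge0 ?ltW// opprK add0r.
rewrite [in RHS]fx -(fineK fip) -(fineK fin).
rewrite -!EFinM -!EFinD /=; ring.
Qed.

End contamination_integral.
End moments.
(** * Block decomposition of the product *)

Section blocks.
Variables (R : realType) (K : nat) (X_ : 'I_K -> euclideanType R).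
Local Notation E := {dffun forall k, X_ k}.
Implicit Types (x y u h : E) (A : 'End(E)).

(** The orthogonal projection of the product onto its factor of index [k]. *)
Definition block_proj k : 'End(E) := (adjoint (tau X_ k) \o tau X_ k)%VF.

Lemma tauE k x : tau X_ k x = x k.
Proof. by rewrite lfunE. Qed.

Lemma edot_prodE x y : edot x y = \sum_k edot (x k) (y k).
Proof. by []. Qed.

Lemma edot_block_proj k x y : edot x (block_proj k y) = edot (x k) (y k).
Proof. by rewrite comp_lfunE -adjointE !tauE. Qed.

Lemma block_projC k x y : edot (block_proj k x) y = edot x (block_proj k y).
Proof. by rewrite edotC !edot_block_proj edotC. Qed.

Lemma block_projE k x : block_proj k x = [ffun j => if j == k then x j else 0].
Proof.
apply: edot_inj => y; rewrite edot_block_proj edot_prodE (bigD1 k)//= ffunE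
  eqxx.
by rewrite big1 ?addr0// => j /negPf jk; rewrite ffunE jk edot0r.
Qed.

Lemma block_projI k l x :
  block_proj k (block_proj l x) = if k == l then block_proj k x else 0.
Proof.
rewrite !block_projE; case: eqVneq => [->|kl]; apply/ffunP => j; rewrite !ffunE.
  by case: eqP.
by case: eqVneq => // ->; rewrite (negPf kl).
Qed.

Lemma edot_diag_part A u h :
  edot u (diag_part A h) = \sum_k edot (block_proj k u) (A (block_proj k h)).
Proof.
rewrite sum_lfunE edot_sumr; apply: eq_bigr => k _.
by rewrite block_projC /block_proj !comp_lfunE.
Qed.

Lemma edot_offdiag_part A u h : edot u (offdiag_part A h) =
  \sum_k \sum_(l | l != k) edot (block_proj k u) (A (block_proj l h)).
Proof.
rewrite sum_lfunE edot_sumr; apply: eq_bigr => k _.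
rewrite sum_lfunE edot_sumr; apply: eq_bigr => l _.
by rewrite block_projC /block_proj !comp_lfunE.
Qed.

Lemma diag_partD A B :
  diag_part (A + B) = diag_part A + diag_part B.
Proof.
apply: lfun_edotP => u h; rewrite add_lfunE edotDr !edot_diag_part.
rewrite -big_split/=; apply: eq_bigr => k _.
by rewrite add_lfunE edotDr.
Qed.

Lemma diag_partZ a A : diag_part (a *: A) = a *: diag_part A.
Proof.
apply: lfun_edotP => u h; rewrite scale_lfunE edotZr !edot_diag_part.
rewrite mulr_sumr; apply: eq_bigr => k _.
by rewrite scale_lfunE edotZr.
Qed.

Lemma offdiag_partD A B :
  offdiag_part (A + B) = offdiag_part A + offdiag_part B.
Proof.
apply: lfun_edotP => u h; rewrite add_lfunE edotDr !edot_offdiag_part.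
rewrite -big_split/=; apply: eq_bigr => k _.
by rewrite -big_split/=; apply: eq_bigr => l _; rewrite add_lfunE edotDr.
Qed.

Lemma offdiag_partZ a A : offdiag_part (a *: A) = a *: offdiag_part A.
Proof.
apply: lfun_edotP => u h; rewrite scale_lfunE edotZr !edot_offdiag_part.
rewrite mulr_sumr; apply: eq_bigr => k _.
by rewrite mulr_sumr; apply: eq_bigr => l _; rewrite scale_lfunE edotZr.
Qed.

(** Only the term of index [(k, l)] survives, since distinct block projections annihilate each
    other. *)
Lemma offdiag_block k l A u h : k != l ->
  edot (block_proj k u) (offdiag_part A (block_proj l h)) =
  edot (block_proj k u) (A (block_proj l h)).
Proof.
move=> kl; rewrite edot_offdiag_part (bigD1 k)//= (bigD1 l) 1?eq_sym//=.
rewrite !block_projI !eqxx !big1 ?addr0// => [i ik|i /andP[_ il]].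
  by rewrite big1// => j _; rewrite block_projI (negPf ik) edot0l.
by rewrite [X in A X]block_projI (negPf il) linear0 edot0r.
Qed.

End blocks.

(** * Derivative of the symmetrized product *)

Section orthogonal_sum.
Variables (R : realType) (E : euclideanType R) (K : nat) (p : 'I_K -> E).
Hypothesis p_orthogonal : forall k l, k != l -> edot (p k) (p l) = 0.
Implicit Types (c : 'I_K -> R).

(** The vectors [p k] are orthogonal but not normalised, and may vanish; hence the factors
    [<p_k, p_k>] in the composition rule. *)
Definition proj_comb c : 'End(E) :=
  \sum_k c k *: tensor (p k) (p k).

Local Notation Q := proj_comb.
Local Notation n := (fun k => edot (p k) (p k)).

Lemma proj_combE c y : Q c y = \sum_k (c k * edot (p k) y) *: p k.
Proof.
rewrite sum_lfunE; apply: eq_bigr => k _.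
by rewrite lfunE/= tensorE scalerA.
Qed.

Lemma proj_combD c c' : Q c + Q c' = Q (fun k => c k + c' k).
Proof. by rewrite -big_split/=; apply: eq_bigr => k _; rewrite scalerDl. Qed.

Lemma proj_combZ a c : a *: Q c = Q (fun k => a * c k).
Proof. by rewrite scaler_sumr; apply: eq_bigr => k _; rewrite scalerA. Qed.

Lemma proj_comb_comp c c' : (Q c \o Q c')%VF = Q (fun k => c k * c' k * n k).
Proof.
apply/lfunP => y; rewrite comp_lfunE !proj_combE; apply: eq_bigr => k _.
rewrite edot_sumr (bigD1 k)//= big1 ?addr0 => [|l lk].
  by rewrite edotZr/=; congr (_ *: _); ring.
by rewrite edotZr p_orthogonal ?mulr0// eq_sym.
Qed.

(** Operators of this form are stable under composition, so square roots and inverses among them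
    become scalar identities on the coefficients. *)
Lemma add1_proj_comb_comp c c' : ((\1 + Q c) \o (\1 + Q c'))%VF =
  \1%VF + Q (fun k => c k + c' k + c k * c' k * n k).
Proof.
rewrite comp_lfunDl !comp_lfunDr !comp_lfun1l comp_lfun1r proj_comb_comp.
rewrite -(proj_combD (fun k => c k + c' k)) -(proj_combD c c') !addrA.
by congr (_ + _); exact: addrAC.
Qed.

Lemma edot_proj_comb c u v :
  edot u (Q c v) = \sum_k c k * edot (p k) u * edot (p k) v.
Proof.
rewrite proj_combE edot_sumr; apply: eq_bigr => k _.
by rewrite edotZr (edotC u) mulrAC.
Qed.

(** For [p k] nonzero and [0 <= e], the eigenvalue at [p k] of the square root of [1 + e D], where
    [D] is the sum of the [p_k (x) p_k]. *)
Definition contaminated_root e k := Num.sqrt (1 + e * n k).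

(* With [q = sqrt (1 + e n)], the inverse square root of [1 + e p (x) p] for a
   vector [p] with [<p, p> = n] is [1 + e r p (x) p] where
   [r = - 1 / (q (1 + q))]; this form of [r] makes sense for [n = 0] too. *)
Definition inv_root_coef e k :=
  - (contaminated_root e k * (1 + contaminated_root e k))^-1.

Definition inv_root e : 'End(E) := \1%VF + e *: Q (inv_root_coef e).

Lemma inv_lsqrt_diag (e : R) : 0 <= e -> e < 1 ->
  inv_lsqrt ((1 - e) *: (\1%VF + e *: Q (fun=> 1))) =
  (Num.sqrt (1 - e))^-1 *: inv_root e.
Proof.
move=> e0 e1; set a := Num.sqrt (1 - e).
have a0 : 0 < a by rewrite sqrtr_gt0 subr_gt0.
have aa : a * a = 1 - e by rewrite -expr2 sqr_sqrtr// subr_ge0 ltW.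
have q2 k : contaminated_root e k ^+ 2 = 1 + e * n k.
  by rewrite sqr_sqrtr// addr_ge0// mulr_ge0// edot_ge0.
have q0 k : 0 < contaminated_root e k.
  by rewrite sqrtr_gt0 ltr_wpDr// mulr_ge0// edot_ge0.
(* The root should act as [1 + s n = q] on [p k]; since [q^2 - 1 = e n], the quotient [(q - 1) / n]
   is [e / (1 + q)], which avoids dividing by [n]. *)
pose s k := e / (1 + contaminated_root e k).
have s0 k : 0 <= s k by rewrite divr_ge0// addr_ge0// ltW.
have en k : e * n k = (contaminated_root e k) ^+ 2 - 1
  by rewrite q2 addrAC subrr add0r.
pose S := a *: (\1%VF + Q s) : 'End(E).
have SE u v : edot u (S v) = a * (edot u v + \sum_k s k * edot (p k) u * edot
  (p k) v).
  by rewrite lfunE/= edotZr lfunE/= edotDr lfunE/= edot_proj_comb.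
have -> : (1 - e) *: (\1%VF + e *: Q (fun=> 1)) = (S \o S)%VF.
  rewrite /S -comp_lfunZl -comp_lfunZr scalerA aa add1_proj_comb_comp
    proj_combZ.
  congr (_ *: (_ + Q _)); apply/funext => k.
  rewrite mulr1.
  have := q0 k; have := en k; rewrite /s.
  move: (contaminated_root e k) (edot (p k) (p k)) => q m em q_gt0.
  have q1 : 1 + q != 0 by rewrite gt_eqF// addr_gt0.
  (* Grouping [e * m] lets [em] eliminate [m] without a division by [e], which may be zero. *)
  transitivity (2 * (e / (1 + q)) + e * (e * m) / (1 + q) ^+ 2).
    by rewrite em; field.
  by field.
apply: inv_lsqrt_eq.
- apply/self_adjointP => u v; rewrite [LHS]edotC !SE (edotC v u).
  by congr (_ * (_ + _)); apply: eq_bigr => k _; rewrite mulrAC.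
- move=> u u0; rewrite edotC SE mulr_gt0// ltr_wpDr ?edot_gt0//.
  by apply: sumr_ge0 => k _; rewrite -mulrA mulr_ge0// -expr2 sqr_ge0.
rewrite /S -comp_lfunZl -comp_lfunZr scalerA divff ?gt_eqF// scale1r.
rewrite /inv_root proj_combZ add1_proj_comb_comp.
(* With [r] the coefficient in [inv_root], this is [s + e r + s e r n = 0]: on [p k], [q] times its
   inverse is 1. *)
rewrite (_ : (fun k => _) = fun=> 0) => [|].
  by rewrite /Q big1 ?addr0// => k _; rewrite scale0r.
apply/funext => k; have := q0 k; have := en k; rewrite /s /inv_root_coef.
move: (contaminated_root e k) (edot (p k) (p k)) => q m em q_gt0.
have q1 : 1 + q != 0 by rewrite gt_eqF// addr_gt0.
have qN0 : q != 0 by rewrite gt_eqF.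
transitivity (e / (1 + q) - e / (q * (1 + q)) - e * (e * m) / ((1 + q) * (q *
  (1 + q)))).
  by field; rewrite q1.
by rewrite em; field; rewrite q1.
Qed.

Variables B G : 'End(E).

(** The product rule at [e = 0] for [inv_root e], [B + e G], [inv_root e]; the value [- 1 / 2] is
    the derivative of [(1 + s)^(- 1 / 2)] at 0. *)
Definition sandwich_derivative : 'End(E) :=
  (Q (fun=> - 2^-1) \o B)%VF + (B \o Q (fun=> - 2^-1))%VF + G.

Lemma inv_root_coef_cvg k : inv_root_coef e k @[e --> (0 : R)^'+] -->
  (- 2^-1 : R).
Proof.
have q1 : contaminated_root e k @[e --> (0 : R)^'+] --> (1 : R).
  rewrite -[X in _ --> X]sqrtr1 -[X in Num.sqrt X](addr0 1).
  rewrite -[X in 1 + X](mul0r (n k)).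
  apply: continuous_cvg; first exact: sqrt_continuous.
  apply: cvgD; first exact: cvg_cst.
  apply: cvgM; last exact: cvg_cst.
  exact: cvg_at_right_filter.
rewrite (_ : 2^-1 = (1 * (1 + 1))^-1); last by rewrite mul1r.
apply: cvgN; apply: cvgV; first by rewrite mul1r.
by apply: cvgM => //; apply: cvgD => //; exact: cvg_cst.
Qed.

(** Expanding the product exhibits the factor [e], so the division disappears and limits can be
    taken term by term. The identity is exact because [Z] will itself depend on [e]. *)
Lemma difference_quotient (Z : 'End(E)) (e : R) : e != 0 ->
  e^-1 *: (((\1 + e *: Z) \o (B + e *: G) \o (\1 + e *: Z))%VF - B) =
  (Z \o B)%VF + (B \o Z)%VF + e *: (Z \o B \o Z)%VF
    + ((\1 + e *: Z) \o G \o (\1 + e *: Z))%VF.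
Proof.
move=> eN0; set W := (\1 + e *: Z)%VF.
have -> : (W \o (B + e *: G) \o W)%VF =
  (W \o B \o W)%VF + e *: (W \o G \o W)%VF.
  move: W => W.
  by rewrite comp_lfunDr comp_lfunDl -comp_lfunZr -comp_lfunZl.
have -> : (W \o B \o W)%VF =
    B + e *: ((Z \o B)%VF + (B \o Z)%VF + e *: (Z \o B \o Z)%VF).
  rewrite /W !comp_lfunDl !comp_lfunDr !comp_lfun1l !comp_lfun1r.
  rewrite !(=^~ comp_lfunZl, =^~ comp_lfunZr) !scalerDr -!addrA; congr (_ + _).
  by rewrite addrCA.
rewrite -[X in X - B]addrA [X in _ *: X]addrC addKr -scalerDr scalerA.
by rewrite mulVf// scale1r.
Qed.

Lemma sandwich_derivativeP :
  hs_norm (e^-1 *: ((inv_root e \o (B + e *: G) \o inv_root e)%VF - B)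
    - sandwich_derivative) @[e --> (0 : R)^'+] --> (0 : R).
Proof.
pose Z e := Q (inv_root_coef e).
pose M e := (Z e \o B)%VF + (B \o Z e)%VF + e *: (Z e \o B \o Z e)%VF
    + ((\1 + e *: Z e) \o G \o (\1 + e *: Z e))%VF.
have : hs_norm (M e - sandwich_derivative) @[e --> (0 : R)^'+] --> (0 : R).
  have idc : e @[e --> (0 : R)^'+] --> (0 : R) by exact: cvg_at_right_filter.
  have Zc : weakly_cvg ((0 : R)^'+) Z (Q (fun=> - 2^-1)).
    apply: weakly_cvg_sum => k; apply: weakly_cvgZ;
      first exact: inv_root_coef_cvg.
    exact: weakly_cvg_cst.
  have cstc L : weakly_cvg ((0 : R)^'+) (fun=> L : 'End(E)) L.
    exact: weakly_cvg_cst.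
  have Wc : weakly_cvg ((0 : R)^'+) (fun e => \1%VF + e *: Z e) \1%VF.
    rewrite -[X in weakly_cvg _ _ X]addr0 -(scale0r (Q (fun=> - 2^-1))).
    by apply: weakly_cvgD => //; exact: weakly_cvgZ.
  apply: weakly_cvg_hs_norm.
  (* The limit is padded with identity factors and a term with coefficient 0, to match [M] term by
     term. *)
  rewrite /sandwich_derivative -[X in _ + _ + X]comp_lfun1l -[X in _ + _ +
    X]comp_lfun1r.
  rewrite -[X in X + _]addr0 -(scale0r (Q (fun=> - 2^-1) \o B \o Q (fun=> -
    2^-1))%VF).
  apply: weakly_cvgD; last by do 2 apply: weakly_cvg_comp => //.
  apply: weakly_cvgD; last by apply: weakly_cvgZ => //;
    do 2 apply: weakly_cvg_comp => //.
  by apply: weakly_cvgD; apply: weakly_cvg_comp.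
apply: cvg_trans; apply: near_eq_cvg; near=> e.
have e0 : 0 < e by near: e; exact: nbhs_right_gt.
by rewrite difference_quotient ?gt_eqF.
Unshelve. all: by end_near.
Qed.

End orthogonal_sum.

(** * The influence function *)

Section influence_formula.
Variables (R : realType) (K : nat) (X_ : 'I_K -> euclideanType R).
Local Notation E := {dffun forall k, X_ k}.
Variables (x : E) (V : 'End(E)).
Hypothesis diagV : diag_part V = \1%VF.

Local Notation p := (fun k => block_proj X_ k x).
Local Notation B := (offdiag_part V).
Local Notation G := (offdiag_part (tensor x x)).

Lemma block_proj_orthogonal k l : k != l -> edot (p k) (p l) = 0.
Proof. by move=> /negPf kl; rewrite block_projC block_projI kl edot0r. Qed.

Lemma diag_part_tensor : diag_part (tensor x x) = proj_comb p (fun=> 1).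
Proof.
apply: lfun_edotP => u h; rewrite edot_diag_part edot_proj_comb.
apply: eq_bigr => k _; rewrite tensorE edotZr mul1r (edotC _ x).
by rewrite -(block_projC k x h) -(block_projC k x u) mulrC.
Qed.

(** The factor [1 - e] of the off-diagonal part cancels against the two factors [(1 - e)^(- 1 / 2)]
    of the inverse roots, whence [e < 1]. *)
Lemma T_functional_contaminated (P : probability (borel E) R) (e : R) :
  0 <= e -> e < 1 ->
  cov_op P = (1 - e) *: (V + e *: tensor x x) ->
  T_functional P = (inv_root p e \o (B + e *: G) \o inv_root p e)%VF.
Proof.
move=> e0 e1 covP.
have dE : diag_part (cov_op P) =
    (1 - e) *: (\1%VF + e *: proj_comb p (fun=> 1)).
  by rewrite covP diag_partZ diag_partD diag_partZ diagV diag_part_tensor.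
have oE : offdiag_part (cov_op P) = (1 - e) *: (B + e *: G).
  by rewrite covP offdiag_partZ offdiag_partD offdiag_partZ.
rewrite /T_functional dE oE (inv_lsqrt_diag block_proj_orthogonal)//.
rewrite !(=^~ comp_lfunZl, =^~ comp_lfunZr) !scalerA.
set a := Num.sqrt (1 - e).
have a0 : 0 < a by rewrite sqrtr_gt0 subr_gt0.
have aa : 1 - e = a * a by rewrite -expr2 sqr_sqrtr// subr_ge0 ltW.
rewrite aa (_ : _ * _ = 1) ?scale1r//.
by field; rewrite gt_eqF.
Qed.

Definition influence_op := sandwich_derivative p B G.

Lemma is_influence_influence_op (mu : probability (borel E) R) :
  (forall e, 0 <= e -> e <= 1 ->
    cov_op (contamination mu x e) = (1 - e) *: (V + e *: tensor x x)) ->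
  cov_op mu = V -> is_influence (@T_functional R K X_) mu x influence_op.
Proof.
move=> cov_cont cov_mu.
have Tmu : T_functional mu = B.
  (* The value at [mu] itself is the case [e = 0] of the same formula. *)
  rewrite (@T_functional_contaminated _ 0)//.
    by rewrite /inv_root !scale0r !addr0 comp_lfun1l comp_lfun1r.
  by rewrite subr0 scale1r scale0r addr0.
have := sandwich_derivativeP p B G; apply: cvg_trans; apply: near_eq_cvg.
near=> e.
have e0 : 0 < e by near: e; exact: nbhs_right_gt.
have e1 : e < 1 by near: e; exact: nbhs_right_lt.
by rewrite Tmu (@T_functional_contaminated _ e) ?cov_cont ?ltW.
Unshelve. all: by end_near.
Qed.

End influence_formula.

(** * Homogeneity and non-vanishing of the influence operator *)

Section nonvanishing.
Variables (R : realType) (K : nat) (X_ : 'I_K -> euclideanType R).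
Local Notation E := {dffun forall k, X_ k}.
Variable V : 'End(E).

(** Each term contains exactly one factor quadratic in [x], either [proj_comb] or [tensor x x]. *)
Lemma influence_opZ t x : influence_op (t *: x) V = t ^+ 2 *: influence_op x V.
Proof.
have QZ c : proj_comb (fun k => block_proj X_ k (t *: x)) c =
    t ^+ 2 *: proj_comb (fun k => block_proj X_ k x) c.
  rewrite scaler_sumr; apply: eq_bigr => k _.
  by rewrite linearZ/= tensorZ !scalerA mulrC.
rewrite /influence_op /sandwich_derivative !QZ tensorZ offdiag_partZ.
by rewrite -comp_lfunZl -comp_lfunZr !scalerDr.
Qed.

(* Changing the sign of one component of [x] leaves [proj_comb] unchanged,
   hence only affects the term [offdiag_part (tensor x x)] of the influence. *)
Lemma exists_influence_op_neq0 : (2 <= K)%N ->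
  (forall k, 0 < \dim {:X_ k})%N -> exists x, influence_op x V != 0.
Proof.
move=> K2 dimX.
pose i : 'I_K := Ordinal (ltn_trans (ltnSn 0) K2).
pose j : 'I_K := Ordinal K2.
have ij : i != j by [].
pose x : E := [ffun k => vpick {:X_ k}].
have x0 k : 0 < edot (block_proj X_ k x) (block_proj X_ k x).
  rewrite block_projC block_projI eqxx edot_block_proj ffunE edot_gt0//.
  by rewrite vpick0 -dimv_eq0 -lt0n.
(* The reflection of [x] that changes the sign of its component of index [i]. *)
pose x' : E := x - 2 *: block_proj X_ i x.
apply: contrapT => nox.
have IF0 y : influence_op y V = 0.
  by apply/eqP; apply: contrapT => /negP y0; apply: nox; exists y.
have px' k : block_proj X_ k x' =
    (if k == i then -1 else 1) *: block_proj X_ k x.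
  rewrite linearB linearZ/= block_projI; case: eqP => [->|_].
    by rewrite scaleN1r scaler_nat mulr2n opprD addrA subrr add0r.
  by rewrite scaler0 subr0 scale1r.
have QE c : proj_comb (fun k => block_proj X_ k x') c =
    proj_comb (fun k => block_proj X_ k x) c.
  apply: eq_bigr => k _; rewrite px' tensorZ; case: ifP => _.
    by rewrite sqrrN expr1n scale1r.
  by rewrite expr1n scale1r.
have GE : offdiag_part (tensor x x) = offdiag_part (tensor x' x').
  apply: (addrI (sandwich_derivative (fun k => block_proj X_ k x)
    (offdiag_part V) 0)).
  have dE y : sandwich_derivative (fun k => block_proj X_ k y)
      (offdiag_part V) 0 + offdiag_part (tensor y y) = 0.
    by rewrite -[RHS](IF0 y) /influence_op /sandwich_derivative addr0.
  have sdE : sandwich_derivative (fun k => block_proj X_ k x')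
      (offdiag_part V) 0 = sandwich_derivative (fun k => block_proj X_ k x)
      (offdiag_part V) 0 by rewrite /sandwich_derivative !QE.
  by rewrite dE -sdE dE.
(* The block [(i, j)] of the equality reads [a = - a], where [a] is the product of the squared norms
   of two nonzero components. *)
have := congr1 (fun A : 'End(E) =>
  edot (block_proj X_ i x) (A (block_proj X_ j x))) GE.
rewrite !offdiag_block// !tensorE !edotZr.
have -> : edot x' (block_proj X_ j x) = edot x (block_proj X_ j x).
  by rewrite -!block_projC px' scale1r.
have -> : edot (block_proj X_ i x) x' = - edot (block_proj X_ i x) x.
  by rewrite block_projC px' eqxx scaleN1r edotNr -block_projC.
have nE k : edot (block_proj X_ k x) x =
    edot (block_proj X_ k x) (block_proj X_ k x).
  by rewrite [RHS]block_projC block_projI eqxx block_projC.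
rewrite (edotC x) !nE; have := mulr_gt0 (x0 i) (x0 j); lra.
Qed.

End nonvanishing.

(** * Covariance of the contaminated distribution *)

Section covariance.
Variables (R : realType) (K : nat) (X_ : 'I_K -> euclideanType R).
Local Notation E := {dffun forall k, X_ k}.
Lemma edot_cov_op (nu : probability (borel E) R) (u v : E) :
  (forall u : E, nu.-integrable setT (EFin \o (fun x : borel E => edot u (x :
    E)))) ->
  (forall u v : E, nu.-integrable setT
    (EFin \o (fun x : borel E => edot u (x : E) * edot v (x : E)))) ->
  edot u (cov_op nu v) = \int[nu]_x (edot v (x : E) * edot u (x : E))
    - (\int[nu]_x edot v (x : E)) * (\int[nu]_x edot u (x : E)).
Proof.
move=> nu1 nu2; rewrite /cov_op add_lfunE opp_lfunE edotBr.
rewrite (edot_vintegral_tensor nu2) tensorE edotZr.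
by rewrite (edot_vintegral nu1) edotC (edot_vintegral nu1).
Qed.

Variable mu : probability (borel E) R.
Local Notation integrableR f := (mu.-integrable setT (EFin \o f)).
Hypothesis mu1 : forall u : E, integrableR (fun x : borel E => edot u (x : E)).
Hypothesis mu2 : forall u v : E,
  integrableR (fun x : borel E => edot u (x : E) * edot v (x : E)).
Hypothesis mean0 : forall u : E, \int[mu]_x edot u (x : E) = 0.

Definition second_moment : 'End(E) :=
  vintegral mu (fun x : borel E => tensor (x : E) (x : E)).

(** The contaminated mean is [e x], and the tensors combine with coefficient
    [e - e^2 = (1 - e) e]. *)
Lemma cov_op_contamination (x : E) e : 0 <= e -> e <= 1 ->
  cov_op (contamination mu x e) = (1 - e) *: (second_moment + e *: tensor x x).
Proof.
move=> e0 e1; apply: lfun_edotP => u v.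
rewrite edot_cov_op; last 2 first.
- by move=> w; exact: integrable_contamination.
- by move=> w w'; exact: integrable_contamination.
rewrite !Rintegral_contamination// !mean0.
rewrite scale_lfunE edotZr add_lfunE edotDr scale_lfunE edotZr tensorE edotZr.
rewrite (edot_vintegral_tensor mu2) (edotC x) (edotC u x); ring.
Qed.

Lemma cov_op_centered : cov_op mu = second_moment.
Proof.
apply: lfun_edotP => u v; rewrite edot_cov_op// !mean0 mulr0 subr0.
by rewrite (edot_vintegral_tensor mu2).
Qed.

End covariance.

(** * From the random vector to its distribution *)

Section transfer.
Variables (R : realType) (K : nat) (X_ : 'I_K -> euclideanType R).
Local Notation E := {dffun forall k, X_ k}.
Variables (d : measure_display) (Omega : measurableType d).
Variables (P : probability Omega R) (X : {RV P >-> borel E}).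
Local Notation integrableR f := (P.-integrable setT (EFin \o f)).
Hypothesis X_square_integrable : forall k,
  (\int[P]_w (enorm (tau X_ k (X w)) ^+ 2)%:E < +oo)%E.

Lemma measurable_edot_RV (u : E) :
  measurable_fun [set: Omega] (fun w => edot u (X w : E)).
Proof. by apply: (measurableT_comp (measurable_edot u));
  exact: measurable_funPT. Qed.

Lemma integrable_edot_sqr :
  integrableR (fun w => edot (X w : E) (X w : E)).
Proof.
apply: integrableR_sum => k.
have -> : (fun w => edot ((X w : E) k) ((X w : E) k)) =
    (fun w => enorm (tau X_ k (X w)) ^+ 2).
  by apply/funext => w; rewrite enorm_sqr tauE.
apply/integrableP; split; last first.
  under eq_integral do rewrite /= ger0_norm ?sqr_ge0//.
  exact: X_square_integrable.
apply/measurable_EFinP.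
(* Measurability: the squared norm of a component is a finite sum of squares of linear forms on the
   whole product. *)
have [n [e [_ eE]]] := exists_orthonormal_family (X_ k).
have -> : (fun w => enorm (tau X_ k (X w)) ^+ 2) =
    fun w => \sum_i (edot (adjoint (tau X_ k) (e i)) (X w : E)) ^+ 2.
  apply/funext => w; rewrite enorm_sqr {1}(eE (tau X_ k (X w))) edot_suml.
  by apply: eq_bigr => i _; rewrite edotZl [in RHS]edotC -adjointE edotC expr2.
apply: measurable_sum => i; apply: measurable_funX.
exact: measurable_edot_RV.
Qed.

Lemma integrable_edotM_RV (u v : E) :
  integrableR (fun w => edot u (X w : E) * edot v (X w : E)).
Proof.
have := integrableRZ (edot u u + edot v v) integrable_edot_sqr.
apply: (le_integrable measurableT) => [|w _] /=.
  apply/measurable_EFinP; apply: measurable_funM; exact: measurable_edot_RV.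
by rewrite lee_fin; apply: le_trans (norm_edotM_le _ _ _) (ler_norm _).
Qed.

(** Domination by [|a| <= 1 + a^2], constants being integrable for a probability. *)
Lemma integrable_edot_RV (u : E) : integrableR (fun w => edot u (X w : E)).
Proof.
have : integrableR (fun w => 1 + edot u (X w : E) * edot u (X w : E)).
  have := integrableD measurableT
    (finite_measure_integrable_cst P 1 measurableT) (integrable_edotM_RV u u).
  by apply: eq_integrable.
apply: (le_integrable measurableT) => [|w _] /=.
  by apply/measurable_EFinP; exact: measurable_edot_RV.
rewrite lee_fin; move: (edot _ _) => a; rewrite [leRHS]ger0_norm; last by nra.
by rewrite ler_norml; apply/andP; split; nra.
Qed.

Lemma Rintegral_RV (f : borel E -> R) : measurable_fun [set: borel E] f ->
  integrableR (f \o X) ->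
  \int[distribution P X]_x f x = \int[P]_w f (X w).
Proof.
by move=> mf fi; rewrite /Rintegral integral_distribution//;
  exact/measurable_EFinP.
Qed.

Lemma integrable_RV (f : borel E -> R) : measurable_fun [set: borel E] f ->
  integrableR (f \o X) -> (distribution P X).-integrable setT (EFin \o f).
Proof.
move=> mf fi; apply: integrable_pushforward => //; exact/measurable_EFinP.
Qed.

End transfer.

(** The first conjunct states that the limits exist, so that the second one speaks of true influence
    functions and not of a default value. *)
Theorem proposition1 (R : realType) (K : nat) (X_ : 'I_K -> euclideanType R)
    (d : measure_display) (Omega : measurableType d) (P : probability Omega R)
    (X : {RV P >-> borel {dffun forall k, X_ k}}) :
  (2 <= K)%N ->
  (forall k, 0 < \dim {:X_ k})%N ->
  (forall k, vintegral P (fun w => tau X_ k (X w)) = 0) ->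
  (forall k, (\int[P]_w (enorm (tau X_ k (X w)) ^+ 2)%:E < +oo)%E) ->
  (forall k, vintegral P
     (fun w => tensor (tau X_ k (X w)) (tau X_ k (X w))) = \1%VF) ->
  (forall x, is_influence (@T_functional R K X_) (distribution P X) x
     (influence (@T_functional R K X_) (distribution P X) x)) /\
  exists x0 : {dffun forall k, X_ k},
    hs_norm (influence (@T_functional R K X_) (distribution P X) (t *: x0))
      @[t --> +oo] --> +oo.
Proof.
move=> K2 dimX mean0 sq_int cov1; set mu := distribution P X.
pose E : euclideanType R := {dffun forall k, X_ k}.
have X1 := integrable_edot_RV sq_int.
have X2 := integrable_edotM_RV sq_int.
have m2 (u v : E) : measurable_fun [set: borel E]
    (fun x : borel E => edot u (x : E) * edot v (x : E)).
  by apply: measurable_funM; exact: measurable_edot.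
have mu1 (u : E) : mu.-integrable setT (EFin \o (fun x : borel E => edot u (x
  : E))).
  by apply: integrable_RV; [exact: measurable_edot|exact: X1].
have mu2 (u v : E) : mu.-integrable setT
    (EFin \o (fun x : borel E => edot u (x : E) * edot v (x : E))).
  by apply: integrable_RV; [exact: m2|exact: X2].
have XkE k (u : X_ k) (w : Omega) :
    edot u (tau X_ k (X w)) = edot (adjoint (tau X_ k) u) (X w : E).
  by rewrite [LHS]edotC [LHS]adjointE [LHS]edotC.
have Xk1 k (u : X_ k) : P.-integrable setT (EFin \o (fun w => edot u (tau X_ k
  (X w)))).
  by under eq_fun do rewrite XkE; exact: X1.
have Xk2 k (u v : X_ k) : P.-integrable setT
    (EFin \o (fun w => edot u (tau X_ k (X w)) * edot v (tau X_ k (X w)))).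
  by under eq_fun do rewrite !XkE; exact: X2.
have mu0 (u : E) : \int[mu]_x edot u (x : E) = 0.
  rewrite Rintegral_RV; [|exact: measurable_edot|exact: X1].
  under eq_Rintegral => w _ do rewrite edot_prodE.
  rewrite Rintegral_sum => [|k]; last first.
    by have := Xk1 k (u k); under eq_fun do rewrite tauE.
  rewrite big1// => k _; rewrite -[RHS](edot0r (u k)) -(mean0 k).
  by rewrite (edot_vintegral (Xk1 k)); apply: eq_Rintegral => w _; rewrite tauE.
(* The diagonal blocks of the second moment are the second moments of the components, here the
   identities. *)
have diagV : diag_part (second_moment mu) = \1%VF.
  apply: lfun_edotP => u v; rewrite edot_diag_part lfunE/= edot_prodE.
  apply: eq_bigr => k _; rewrite (edot_vintegral_tensor mu2).
  rewrite Rintegral_RV; [|exact: m2|exact: X2].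
  have := congr1 (fun A : 'End(X_ k) => edot (u k) (A (v k))) (cov1 k).
  rewrite id_lfunE => <-; rewrite (edot_vintegral_tensor (Xk2 k)).
  by apply: eq_Rintegral => w _; rewrite !block_projC !edot_block_proj !tauE.
have IFP x : is_influence (@T_functional R K X_) mu x
    (influence_op x (second_moment mu)).
  apply: is_influence_influence_op => //.
    by move=> e e0 e1; exact: cov_op_contamination.
  exact: cov_op_centered.
(* The explicit limit shows that the choice in [influence] succeeds; uniqueness of limits then
   identifies the two. *)
have IFE x : is_influence (@T_functional R K X_) mu x
    (influence (@T_functional R K X_) mu x).
  rewrite /influence; case: xgetP => [//|noL].
  by case: (noL _ (IFP x)).
have influenceE x : influence (@T_functional R K X_) mu x =
    influence_op x (second_moment mu).
  exact: hs_norm_cvg_unique (IFE x) (IFP x).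
split=> //.
have [x0 IF0] := exists_influence_op_neq0 (second_moment mu) K2 dimX.
exists x0; under eq_fun do rewrite influenceE influence_opZ hs_normZ.
have h0 : 0 < hs_norm (influence_op x0 (second_moment mu)).
  rewrite lt_neqAle hs_norm_ge0 andbT eq_sym.
  by apply: contra_neq IF0; exact: hs_norm_eq0.
set h := hs_norm _ in h0 *.
apply/cvgryPge => A; near=> t.
(* For [t >= 1] and [t >= A / h] one has [A <= t h <= t^2 h]. *)
have t1 : 1 <= t by near: t; exact: nbhs_pinfty_ge.
have tA : A / h <= t by near: t; apply: nbhs_pinfty_ge; rewrite num_real.
rewrite ler_pdivrMr// in tA; rewrite ger0_norm ?sqr_ge0//.
apply: le_trans tA _; rewrite ler_pM2r// expr2 ler_peMl// (le_trans _ t1).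
Unshelve. all: by end_near.
Qed.
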